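(* Let $\mathbf{X}=(X_1,\dots,X_d)$ be a continuous random vector in $\mathbb{R}^d$ with joint probability density function $f_X$ (the components are not assumed to be independent). Let $g:\mathbb{R}^d\to\mathbb{R}$ be a differentiable deterministic function whose partial derivatives are square integrable, i.e. $\mathbb{E}\big[(\partial g(\mathbf{X})/\partial x_j)^2\big]<\infty$ for $j=1,\dots,d$, and let $Y=g(\mathbf{X})$. For $i\in\{1,\dots,d\}$ let $$\kappa_{T_i}=\frac{e^{H_{T_i}}}{e^{H(Y)}},\qquad l_i=\mathbb{E}\left[\ln\left|\frac{\partial g(\mathbf{X})}{\partial x_i}\right|\right],\qquad \nu_i=\mathbb{E}\left[\left(\frac{\partial g(\mathbf{X})}{\partial x_i}\right)^2\right],$$ where $H_{T_i}=\mathbb{E}[H(Y\mid\mathbf{X}_{\sim i})]$. Then for every $i$, $$\kappa_{T_i}\;\le\;\frac{e^{H(X_i)}}{e^{H(Y)}}\,e^{l_i}\qquad\text{and}\qquad \kappa_{T_i}^2=\frac{e^{2H_{T_i}}}{e^{2H(Y)}}\;\le\;\frac{e^{2H(X_i)}}{e^{2H(Y)}}\,\nu_i .$$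
   Context: All logarithms are natural. For a continuous random variable (or vector) $Z$ with density $f$, the differential entropy is $H(Z)=-\int f(z)\ln f(z)\,dz$, the integral being over the support of $Z$. $\mathbf{X}_{\sim i}$ denotes the vector of all inputs $X_1,\dots,X_d$ except $X_i$. The conditional differential entropy (total effect entropy) is $$H_{T_i}=\mathbb{E}[H(Y\mid \mathbf{X}_{\sim i})]=-\int f(y,\mathbf{x}_{\sim i})\ln f(y\mid \mathbf{x}_{\sim i})\,dy\,d\mathbf{x}_{\sim i},$$ where $f(y,\mathbf{x}_{\sim i})$ is the joint density of $(Y,\mathbf{X}_{\sim i})$ and $f(y\mid\mathbf{x}_{\sim i})$ is the conditional density of $Y$ given $\mathbf{X}_{\sim i}=\mathbf{x}_{\sim i}$. The quantity $\kappa_{T_i}$ is called the exponential entropy based total sensitivity index, and $\nu_i$ the derivative-based global sensitivity measure (DGSM). It is a standing assumption that the densities involved exist and that the entropies and expectations involved (including $H(Y)$ and the joint entropies of $\mathbf{X}$, of $\mathbf{X}_{\sim i}$ and of $(Y,\mathbf{X}_{\sim i})$) are well defined and finite. *)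

(* Defs.v *)
From HB Require Import structures.
From mathcomp Require Import all_boot all_order all_algebra.
From mathcomp Require Import all_classical all_reals all_analysis.

Set Implicit Arguments.
Unset Strict Implicit.
Unset Printing Implicit Defensive.

Import Order.TTheory GRing.Theory Num.Theory.
Import numFieldNormedType.Exports.

(* R^n is n.-tuple (measurableTypeR R) for measures, and
   'rV[R]_n for differentiability; row_of_tuple goes from the former to the
   latter. *)

Local Open Scope classical_set_scope.
Local Open Scope ring_scope.

Section lebesgue_tuple.
Context {R : realType}.
Local Open Scope ereal_scope.

Definition cons_pair n (p : measurableTypeR R * n.-tuple (measurableTypeR R)) :
  n.+1.-tuple (measurableTypeR R) := [tuple of p.1 :: p.2].

Lemma measurable_cons_pair n : measurable_fun [set: _] (@cons_pair n).
Proof. exact: measurable_cons. Qed.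

Section lebesgue_cons.
Variables (n : nat)
  (mu : {sigma_finite_measure set (n.-tuple (measurableTypeR R)) -> \bar R}).

Definition lebesgue_cons : set (n.+1.-tuple (measurableTypeR R)) -> \bar R :=
  pushforward (@lebesgue_measure R \x mu) (@cons_pair n).

Let lebesgue_cons0 : lebesgue_cons set0 = 0.
Proof. by rewrite /lebesgue_cons /pushforward preimage_set0 (measure0 (lebesgue_measure \x mu)). Qed.

Let lebesgue_cons_ge0 A : 0 <= lebesgue_cons A.
Proof. exact: (measure_ge0 (lebesgue_measure \x mu)). Qed.

Let lebesgue_cons_sigma_additive : semi_sigma_additive lebesgue_cons.
Proof.
apply: measure_semi_sigma_additive => //; exact: measurable_cons_pair.
Qed.

HB.instance Definition _ := isMeasure.Build _ _ _ lebesgue_cons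
  lebesgue_cons0 lebesgue_cons_ge0 lebesgue_cons_sigma_additive.

Let lebesgue_cons_sigma_finite : sigma_finite setT lebesgue_cons.
Proof.
have /sigma_finiteP[F [TF ndF Foo]] := sigma_finiteT (@lebesgue_measure R).
have /sigma_finiteP[G [TG ndG Goo]] := sigma_finiteT mu.
pose H k := [set t : n.+1.-tuple (measurableTypeR R) |
  F k (thead t) /\ G k [tuple of behead t]].
have HE k : @cons_pair n @^-1` H k = F k `*` G k.
  apply/seteqP; split => -[x t]; rewrite /H /cons_pair/= => -[Fx];
    by rewrite (_ : [tuple of _] = t)//; exact/val_inj.
exists H.
  apply/esym/seteqP; split => // t _.
  have [k1 _ Fk1] : (\bigcup_i F i) (thead t) by rewrite -TF.
  have [k2 _ Gk2] : (\bigcup_i G i) [tuple of behead t] by rewrite -TG.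
  exists (maxn k1 k2) => //; split.
  - by move: Fk1; exact/subsetPset/ndF/leq_maxl.
  - by move: Gk2; exact/subsetPset/ndG/leq_maxr.
move=> k; have [mF Fk] := Foo k; have [mG Gk] := Goo k; split.
  apply: measurableI.
  - rewrite -[X in measurable X]setTI.
    exact: (@measurable_tnth _ (measurableTypeR R) _ ord0).
  - by rewrite -[X in measurable X]setTI; exact: measurable_behead.
rewrite /lebesgue_cons /pushforward HE product_measure1E//.
by rewrite lte_mul_pinfty// ge0_fin_numE.
Qed.

HB.instance Definition _ := Measure_isSigmaFinite.Build _ _ _
  lebesgue_cons lebesgue_cons_sigma_finite.

End lebesgue_cons.

Fixpoint lebesgue_tuple n :
    {sigma_finite_measure set (n.-tuple (measurableTypeR R)) -> \bar R} :=
  if n is n'.+1 then lebesgue_cons (lebesgue_tuple n')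
  else \d_([tuple] : 0.-tuple (measurableTypeR R)).

End lebesgue_tuple.

(* Together with sigma-additivity, the value on boxes characterizes the
   Lebesgue measure on R^n. *)
Lemma lebesgue_tuple_box (R : realType) n (A : 'I_n -> set (measurableTypeR R)) :
  (forall i, measurable (A i)) ->
  (lebesgue_tuple n [set t | forall i, A i (tnth t i)] =
   \prod_(i < n) lebesgue_measure (A i))%E.
Proof.
elim: n A => [|n IHn] A mA.
  rewrite big_ord0 /= diracE mem_set//= => -[].
  by move=> m mlt0; exfalso; rewrite ltn0 in mlt0.
rewrite big_ord_recl -IHn//=.
rewrite /lebesgue_cons /pushforward -product_measure1E//; last first.
  rewrite (_ : mkset _ = \bigcap_(i in [set: 'I_n])
    ((@tnth n (measurableTypeR R))^~ i @^-1` A (lift ord0 i))); last first.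
    by apply/seteqP; split => t /= tA i; [move=> _|]; exact: tA.
  apply: fin_bigcap_measurable; first exact: finite_finset.
  move=> i _; rewrite -[X in measurable X]setTI.
  exact: (@measurable_tnth _ (measurableTypeR R) n i).
congr (_ _); apply/seteqP; split => -[x t] /=.
  move=> xtA; split; first exact: (xtA ord0).
  by move=> i; have := xtA (lift ord0 i); rewrite /cons_pair tnthS.
move=> [Ax At] i; rewrite /cons_pair.
by have [j ->|->] := unliftP ord0 i; [rewrite tnthS; exact: At|exact: Ax].
Qed.

Section random_vector.
Context {R : realType}.

Definition row_of_tuple n (x : n.-tuple R) : 'rV[R]_n := \row_j tnth x j.

(* x_{~i}: the coordinate i is removed. *)
Definition drop_coord (T : Type) n (i : 'I_n) (x : n.-tuple T) :
  n.-1.-tuple T := [tuple tnth x (lift i j) | j < n.-1].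

Definition partial n (g : 'rV[R]_n -> R) (i : 'I_n) (x : 'rV[R]_n) : R :=
  'D_(delta_mx 0 i) g x.

End random_vector.

Section entropy.
Local Open Scope ereal_scope.
Context {R : realType}.

Definition has_pdf d d' (T : measurableType d) (U : measurableType d')
    (mu : {measure set U -> \bar R}) (P : probability T R)
    (Z : T -> U) (f : U -> R) : Prop :=
  [/\ measurable_fun setT f, (forall u, (0 <= f u)%R) &
      forall A, measurable A -> P (Z @^-1` A) = \int[mu]_(u in A) (f u)%:E].

Definition diff_entropy d (U : measurableType d)
    (mu : {measure set U -> \bar R}) (f : U -> R) : R :=
  (- \int[mu]_(u in [set u | (0 < f u)%R]) (f u * ln (f u)))%R.

Definition finite_entropy d (U : measurableType d)
    (mu : {measure set U -> \bar R}) (f : U -> R) : Prop :=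
  mu.-integrable [set u | (0 < f u)%R] (fun u => (f u * ln (f u))%:E).

(* The density y |-> f(y | z) of Y given Z = z, from a density fYZ of (Y, Z)
   and a density fZ of Z. Where fZ z = 0, an event of probability 0 for Z, the
   quotient is 0 for every y. *)
Definition cond_pdf (Y U : Type) (fYZ : Y * U -> R) (fZ : U -> R)
    (z : U) (y : Y) : R :=
  (fYZ (y, z) / fZ z)%R.

(* E[H(Y | Z)], for a real-valued Y: the average over Z of the entropy of the
   conditional density of Y given the value of Z. *)
Definition cond_entropy d d' (T : measurableType d) (U : measurableType d')
    (P : probability T R) (Z : T -> U)
    (fYZ : measurableTypeR R * U -> R) (fZ : U -> R) : R :=
  fine 'E_P[fun w => diff_entropy lebesgue_measure (cond_pdf fYZ fZ (Z w))].

End entropy.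

(* Main.v *)
(* Write Z for X_{~i}, p for the density of (X_i, Z), q for that of (Y, Z). By
   Fubini H_{T_i} = H(Y, Z) - H(Z) = E[ln f_Z(Z) - ln q(Y, Z)].

   The change of variables is only needed as the almost sure inequality
   p(X_i, Z) <= q(Y, Z) |dg/dx_i(X)|. For almost every z the density q(., z) is
   that of the image of p(., z) dx under h = g(., z), so that p-mass near x is
   at most the q-mass of the image interval, whose length is about |h'(x)| times
   larger; Lebesgue differentiation at x and at h(x) concludes.

   Hence ln f_{X_i}(X_i) + ln f_Z(Z) - ln q(Y, Z) - ln |dg/dx_i| is at most
   ln (f_{X_i} f_Z / p) <= f_{X_i} f_Z / p - 1 almost surely, and the latter has
   expectation <= 0 (Gibbs): this is H_{T_i} <= H(X_i) + l_i. The second bound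
   follows from e^{2 l_i} <= nu_i, which is Jensen's inequality. *)
Require Import Defs.
From HB Require Import structures.
From mathcomp Require Import all_boot all_order all_algebra.
From mathcomp Require Import all_classical all_reals all_analysis measurable_realfun.
From mathcomp Require Import ring lra.
Set Implicit Arguments.
Unset Strict Implicit.
Unset Printing Implicit Defensive.
Import Order.TTheory GRing.Theory Num.Theory.
Import numFieldNormedType.Exports.
Local Open Scope classical_set_scope.
Local Open Scope ring_scope.

(** * Image of a density under a differentiable function of one variable *)

(** Lebesgue differentiation along the balls of radius [c / n.+1%:R], whose measure is twice the
    radius. The free factor [c] allows balls of different sizes at a point and at its image. *)
Lemma ball_average_cvg (R : realType) (f : R -> R) (x c : R) : 0 < c ->
  locally_integrable setT f -> lebesgue_pt f x ->
  ((((c / n.+1%:R) *+ 2)^-1)%:E *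
    \int[lebesgue_measure]_(y in ball x (c / n.+1%:R)) (f y)%:E)%E
    @[n --> \oo] --> (f x)%:E.
Proof.
move=> c0 lf fx.
have r0 n : 0 < c / n.+1%:R by rewrite divr_gt0.
have := @nice_lebesgue_differentiation R (fun y n => ball y (c / n.+1%:R)) _ f lf x fx.
under eq_fun => n.
  rewrite lebesgue_measure_ball ?ltW// inver mulrn_eq0/= gt_eqF//.
  over.
apply => y; split; first by move=> n; exact: measurable_ball.
exists (1, (fun n => PosNum (r0 n))); split => //=; [|by move=> n|by move=> n; rewrite mul1e].
by rewrite -[X in _ --> X](mulr0 c); apply: cvgM; [exact: cvg_cst|exact: (@cvg_harmonic R)].
Qed.

(** Close to [x] the difference quotients of [h] stay below [c] in absolute value, so [h] enlarges
    small balls around [x] by a factor of at most [c]. *)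
Lemma ball_sub_preimage_near (R : realType) (h : R -> R) (x a c : R) :
  is_derive x 1 h a -> `|a| < c ->
  \forall n \near \oo, ball x (1 / n.+1%:R) `<=` h @^-1` ball (h x) (c / n.+1%:R).
Proof.
move=> [dh Dh] ac; have c0 : 0 < c by exact: le_lt_trans ac.
have : \forall s \near 0^', `|s^-1 *: (h (s *: 1 + x) - h x)| < c.
  have /cvg_norm : s^-1 *: (h (s *: 1 + x) - h x) @[s --> 0^'] --> a.
    by rewrite -Dh; exact: dh.
  by move/cvgr_lt; apply.
rewrite near_withinE => -[e/= e0 he].
have /cvgr0Pnorm_lt/(_ _ e0) : @GRing.inv R n.+1%:R @[n --> \oo] --> 0 by exact: cvg_harmonic.
apply: filterS => n ne y; rewrite /ball/= div1r => xy.
(* The bound on difference quotients holds on a punctured neighbourhood only, so the centre is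
   treated apart. *)
have [->|yx] := eqVneq y x; first by rewrite subrr normr0 divr_gt0.
have yx0 : y - x != 0 by rewrite subr_eq0.
have := he (y - x); rewrite /= sub0r normrN.
have ne' : `|y - x| < e by rewrite distrC; apply: lt_trans xy _; move: ne; rewrite ger0_norm.
move=> /(_ ne' yx0); rewrite /GRing.scale/= mulr1 subrK normrM normfV.
rewrite ltr_pdivrMl ?normr_gt0// => H.
rewrite distrC; apply: lt_le_trans H _.
by rewrite distrC mulrC ler_wpM2l// ?ltW.
Qed.

(** A ball around [x] is compared with the whole preimage of a ball around [h x], which may also
    contain points far from [x]. This is why an inequality comes out, and why [h] may fail to be
    injective. *)
Lemma density_le_pullback (R : realType) (h h' p q : R -> R) :
  measurable_fun setT p -> measurable_fun setT q ->
  (forall x, 0 <= p x) -> (forall x, 0 <= q x) ->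
  lebesgue_measure.-integrable setT (EFin \o p) ->
  lebesgue_measure.-integrable setT (EFin \o q) ->
  (forall x : R, is_derive x (1 : R) h (h' x)) ->
  (forall C : set (measurableTypeR R), measurable C ->
    \int[lebesgue_measure]_(y in C) (q y)%:E =
    \int[lebesgue_measure]_(x in h @^-1` C) (p x)%:E)%E ->
  {ae lebesgue_measure, forall x, p x <= q (h x) * `|h' x|}.
Proof.
move=> mp mq p0 q0 ip iq hh' pq.
have ch : continuous h.
  move=> x; apply: differentiable_continuous; apply/derivable1_diffP.
  by have [] := hh' x.
have mh : measurable_fun setT (h : measurableTypeR R -> measurableTypeR R).
  exact: continuous_measurable_fun.
have mhC C : measurable C -> measurable (h @^-1` C).
  by move=> mC; rewrite -[X in measurable X]setTI; exact: mh.
have lp : locally_integrable setT p by apply: open_integrable_locally => //; exact: openT.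
have lq : locally_integrable setT q by apply: open_integrable_locally => //; exact: openT.
have [N [mN N0 Nq]] := lebesgue_differentiation lq.
(* points sent to a non-Lebesgue point of q carry no p-mass *)
have pN : {ae lebesgue_measure, forall x, (h @^-1` N) x -> p x = 0}.
  have : (\int[lebesgue_measure]_(x in h @^-1` N) `|(p x)%:E| = 0)%E.
    under eq_integral do rewrite gee0_abs ?lee_fin//.
    by rewrite -pq// null_set_integral//; apply/measurable_EFinP; exact: measurable_funTS.
  move/ae_eq_integral_abs => /(_ (mhC _ mN)).
  have /[swap]/[apply] : measurable_fun (h @^-1` N) (EFin \o p).
    by apply/measurable_EFinP; exact: measurable_funTS.
  by apply: filterS => x /[apply] -[].
have := lebesgue_differentiation lp.
apply: (@filterS2 _ _ (ae_filter_ringOfSetsType lebesgue_measure)) pN => x pN px.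
have [hN|hN] := pselect ((h @^-1` N) x); first by rewrite pN// mulr_ge0.
have {hN Nq}qx : lebesgue_pt q (h x) by apply: contrapT => qx; apply: hN; exact: Nq.
apply/ler_addgt0Pr => e e0.
(* the slack K absorbs the error of the first-order expansion of h at x *)
have [K K0 HK] : exists2 K, 0 < K & q (h x) * K <= e.
  (* The added 1 keeps the denominator positive when [q (h x) = 0]. *)
  exists (e / (q (h x) + 1)); first by rewrite divr_gt0// ltr_wpDl.
  by rewrite mulrCA ger_pMr// ler_pdivrMr ?ltr_wpDl// mul1r lerDl.
pose c : R := `|h' x| + K.
have c0 : 0 < c by rewrite ltr_wpDl.
suff : p x <= c * q (h x).
  by move/le_trans; apply; rewrite /c mulrC mulrDr lerD2l.
rewrite -lee_fin EFinM.
have Cp := ball_average_cvg ltr01 lp px.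
have /(@cvgeZl _ _ _ _ _ c%:E isT) Cq := ball_average_cvg c0 lq qx.
rewrite -(cvg_lim (@ereal_hausdorff R) Cp) -(cvg_lim (@ereal_hausdorff R) Cq).
apply: lee_lim; [by apply/cvg_ex; eexists; exact: Cp|by apply/cvg_ex; eexists; exact: Cq|].
have hc : `|h' x| < c by rewrite ltrDl.
have := ball_sub_preimage_near (hh' x) hc; apply: filterS => n Bn.
rewrite muleA -EFinM.
(* The ratio of the two radii is [c], so both averages carry the same normalising constant and only
   the masses remain to be compared. *)
have -> : c * (c / n.+1%:R *+ 2)^-1 = (1 / n.+1%:R *+ 2)^-1.
  by rewrite -mulr_natr -(mulr_natr (1 / _)) !invfM !mulrA mulfV ?gt_eqF// invr1.
rewrite lee_wpmul2l ?lee_fin ?invr_ge0 ?mulrn_wge0//.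
rewrite pq; last exact: measurable_ball.
apply: ge0_subset_integral => //; first exact: measurable_ball.
- by apply: mhC; exact: measurable_ball.
- by apply/measurable_EFinP; exact: measurable_funTS.
- by move=> ? _; rewrite lee_fin.
Qed.

(** * Expectations of functions of a variable with a density *)

Import HBNNSimple.

(** Both sides are monotone limits along simple functions approximating [phi]; by linearity the
    claim reduces to indicators, where it is the hypothesis on [nu]. *)
Lemma ge0_integral_density d (U : measurableType d) (R : realType)
    (mu nu : {measure set U -> \bar R}) (f : U -> R) :
  measurable_fun setT f -> (forall u, 0 <= f u) ->
  (forall A, measurable A -> nu A = \int[mu]_(u in A) (f u)%:E)%E ->
  forall phi : U -> \bar R, measurable_fun setT phi -> (forall u, 0 <= phi u)%E ->
  (\int[nu]_u phi u = \int[mu]_u (phi u * (f u)%:E))%E.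
Proof.
move=> mf f0 nuE phi mphi phi0.
pose h := nnsfun_approx measurableT mphi.
have hphi u : (EFin \o h n) u @[n --> \oo] --> phi u by exact: cvg_nnsfun_approx.
have ndh u m n : (m <= n)%N -> h m u <= h n u.
  by move=> mn; exact/lefP/nd_nnsfun_approx.
have -> : (\int[nu]_u phi u = limn (fun n => \int[nu]_u (h n u)%:E))%E.
  under eq_integral => u _ do rewrite -(cvg_lim (@ereal_hausdorff R) (hphi u)).
  apply: monotone_convergence => //.
  - by move=> n; exact/measurable_EFinP.
  - by move=> n u _; rewrite lee_fin.
  - by move=> u _ m n mn; rewrite lee_fin ndh.
have -> : (\int[mu]_u (phi u * (f u)%:E) = limn (fun n => \int[mu]_u ((h n u)%:E * (f u)%:E)))%E.
  have hf u : ((h n u)%:E * (f u)%:E)%E @[n --> \oo] --> (phi u * (f u)%:E)%E.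
    exact: cvgeZr (hphi u).
  under eq_integral => u _ do rewrite -(cvg_lim (@ereal_hausdorff R) (hf u)).
  apply: monotone_convergence => //.
  - by move=> n; apply: emeasurable_funM; exact/measurable_EFinP.
  - by move=> n u _; rewrite mule_ge0 ?lee_fin.
  - by move=> u _ m n mn; rewrite lee_wpmul2r ?lee_fin ?ndh.
congr (limn _); apply/funext => n.
have mh r : measurable (h n @^-1` [set r]).
  by rewrite -[X in measurable X]setTI; exact: measurable_funP.
have hr r : r \in range (h n) -> 0 <= r by rewrite inE => -[u _ <-].
transitivity (\sum_(r \in range (h n)) (r%:E * nu (h n @^-1` [set r])))%E.
  by rewrite integralT_nnsfun sintegralE.
transitivity (\int[mu]_u (\sum_(r \in range (h n))
    (r * \1_(h n @^-1` [set r]) u)%:E * (f u)%:E))%E; last first.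
  apply: eq_integral => u _; rewrite -ge0_mule_fsuml.
    by rewrite fsumEFin// -fimfunE.
  by move=> r; rewrite EFinM nnfun_muleindic_ge0.
have mhf r : measurable_fun setT (fun u => (\1_(h n @^-1` [set r]) u)%:E * (f u)%:E)%E.
  by apply: emeasurable_funM; apply/measurable_EFinP => //; exact: measurable_indic.
rewrite ge0_integral_fsum//; last 2 first.
- move=> r; under eq_fun do rewrite EFinM -muleA.
  by apply: emeasurable_funM => //; exact: measurable_cst.
- by move=> r u _; rewrite mule_ge0 ?lee_fin// -lee_fin EFinM nnfun_muleindic_ge0.
apply: eq_fsbigr => r rh.
under eq_integral do rewrite EFinM -muleA.
rewrite ge0_integralZl//; last 2 first.
- by move=> u _; rewrite mule_ge0 ?lee_fin.
- by rewrite lee_fin hr.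
congr (_ * _)%E; rewrite nuE// [LHS]integral_mkcond; apply: eq_integral => u _.
by rewrite patchE indicE; case: ifPn => _; rewrite ?mul1e ?mul0e.
Qed.

Section pdf.
Context d d' (T : measurableType d) (U : measurableType d') (R : realType)
  (mu : {measure set U -> \bar R}) (P : probability T R) (Z : T -> U) (f : U -> R).
Context (mZ : measurable_fun setT Z) (fZ : has_pdf mu P Z f).

Let mZpack : {mfun T >-> U} := HB.pack Z (isMeasurableFun.Build _ _ _ _ _ mZ).

Lemma ge0_integral_pdf (phi : U -> \bar R) :
  measurable_fun setT phi -> (forall u, 0 <= phi u)%E ->
  (\int[P]_w phi (Z w) = \int[mu]_u (phi u * (f u)%:E))%E.
Proof.
move=> mphi phi0; have [mf f0 fE] := fZ.
rewrite -(@ge0_integral_density _ _ _ mu (distribution P mZpack) f)//.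
by rewrite ge0_integral_pushforward//=.
Qed.

(** Since [f] is nonnegative, the positive and negative parts of [phi * f] are those of [phi] times
    [f], which reduces the signed case to the nonnegative one. *)
Lemma integrable_pdf (phi : U -> R) : measurable_fun setT phi ->
  mu.-integrable setT (fun u => (phi u * f u)%:E) ->
  P.-integrable setT (fun w => (phi (Z w))%:E) /\
  (\int[P]_w (phi (Z w))%:E = \int[mu]_u (phi u * f u)%:E)%E.
Proof.
move=> mphi iphi; have [mf f0 fE] := fZ; split.
  apply/integrableP; split; first exact/measurable_EFinP/measurableT_comp.
  rewrite (ge0_integral_pdf (phi := fun u => `|phi u|%:E))//; last first.
    exact/measurable_EFinP/measurableT_comp.
  have /integrableP[_] := iphi.
  by under eq_integral do rewrite EFinM abseM (@gee0_abs _ (f _)%:E) ?lee_fin//.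
rewrite [LHS]integralE [RHS]integralE.
rewrite (eq_integral _ _ (fun w _ => funeposE _ w)) (eq_integral _ _ (fun w _ => funenegE _ w)).
have mphiE : measurable_fun setT (EFin \o phi) by exact/measurable_EFinP.
congr (_ - _)%E.
- rewrite (ge0_integral_pdf (phi := fun u => maxe (phi u)%:E 0))//; last 2 first.
  + exact: measurable_maxe.
  + by move=> u; rewrite le_max lexx orbT.
  apply: eq_integral => u _; rewrite funeposE/=.
  by rewrite -!EFin_max -EFinM maxr_pMl// mul0r.
- rewrite (ge0_integral_pdf (phi := fun u => maxe (- (phi u)%:E)%E 0))//; last 2 first.
  + by apply: measurable_maxe => //; apply: measurableT_comp mphiE; exact: oppe_measurable.
  + by move=> u; rewrite le_max lexx orbT.
  apply: eq_integral => u _; rewrite funenegE/=.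
  by rewrite -!EFin_max -EFinM maxr_pMl// mul0r mulNr.
Qed.

(** Almost surely [Z] avoids both a given [mu]-null set and the zero set of [f], as each has
    integral 0 against [f]. *)
Lemma ae_pdf (Q : U -> Prop) : {ae mu, forall u, 0 < f u -> Q u} ->
  {ae P, forall w, Q (Z w)}.
Proof.
move=> [N [mN N0 NQ]]; have [mf f0 fE] := fZ.
have mf0 : measurable (f @^-1` [set 0]).
  by rewrite -[X in measurable X]setTI; exact: mf.
have mZ' A : measurable A -> measurable (Z @^-1` A).
  by move=> mA; rewrite -[X in measurable X]setTI; exact: mZ.
have PN : {ae P, forall w, ~ N (Z w)}.
  exists (Z @^-1` N); split; [exact: mZ'| |by move=> w /= /contrapT].
  by rewrite fE// null_set_integral//; exact/measurable_EFinP/measurable_funTS.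
have P0 : {ae P, forall w, f (Z w) != 0}.
  exists (Z @^-1` (f @^-1` [set 0])); split; first exact: mZ'.
  - by rewrite fE// integral0_eq// => u ->.
  - by move=> w /= /negP; rewrite negbK => /eqP.
apply: filterS2 P0 PN => w fw NZ; apply: contrapT => nQ.
by apply/NZ/NQ => /= /(_ _)/nQ; apply; rewrite lt_neqAle eq_sym fw f0.
Qed.

Lemma ae_pdf_gt0 : {ae P, forall w, 0 < f (Z w)}.
Proof. by apply: (@ae_pdf (fun u => 0 < f u)); exact: aeW. Qed.

(** This rewrites an entropy as an expectation, minus [E[ln f(Z)]], so that different entropies can
    be compared pointwise on the probability space. *)
Lemma finite_entropy_pdf : finite_entropy mu f ->
  P.-integrable setT (fun w => (ln (f (Z w)))%:E) /\
  (\int[P]_w (ln (f (Z w)))%:E = (- diff_entropy mu f)%:E)%E.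
Proof.
have [mf f0 fE] := fZ; move=> ef.
have mD : measurable [set u | (0 < f u)%R].
  rewrite (_ : mkset _ = f @^-1` `]0, +oo[); last first.
    by apply/seteqP; split => u /=; rewrite in_itv/= andbT.
  by rewrite -[X in measurable X]setTI; exact: mf.
(* [ln] is 0 at nonpositive reals, so the integrand already vanishes off the support. *)
have lE : (fun u => (ln (f u) * f u)%:E) =
    ((fun u => (f u * ln (f u))%:E) \_ [set u | (0 < f u)%R]).
  apply/funext => u; rewrite patchE; case: ifPn => [_|]; first by rewrite mulrC.
  by rewrite notin_setE/= => /negP; rewrite -leNgt => /ln0 ->; rewrite mul0r.
have il : mu.-integrable setT (fun u => (ln (f u) * f u)%:E).
  by rewrite lE; apply/integrable_restrict => //; rewrite setTI.
have [i1 ->] := @integrable_pdf (@ln R \o f) (measurableT_comp (@measurable_ln R) mf) il.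
split => //; rewrite /= lE -integral_mkcond /diff_entropy opprK /Rintegral fineK//.
exact: integrable_fin_num.
Qed.

End pdf.

(** * Uniqueness of finite Borel measures from countably many test sets *)

Section pushforward_density.
Context d d' (X : measurableType d) (Y : measurableType d') (R : realType)
  (mu : {measure set X -> \bar R}) (f : X -> R) (phi : X -> Y)
  (mf : measurable_fun setT f) (f0 : forall x, 0 <= f x)
  (mphi : measurable_fun setT phi).
Local Open Scope ereal_scope.

(* The proofs are arguments so that the measure structure can be inferred. *)
Definition pushforward_density of measurable_fun setT f & (forall x, (0 <= f x)%R) &
    measurable_fun setT phi := fun A : set Y => \int[mu]_(x in phi @^-1` A) (f x)%:E.

Local Notation nu := (pushforward_density mf f0 mphi).

Let nu0 : nu set0 = 0.
Proof. by rewrite /pushforward_density preimage_set0 integral_set0. Qed.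

Let nu_ge0 A : 0 <= nu A.
Proof. by apply: integral_ge0 => x _; rewrite lee_fin. Qed.

Let nu_sigma_additive : semi_sigma_additive nu.
Proof.
move=> A mA tA mUA; rewrite /pushforward_density preimage_bigcup ge0_integral_bigcup//.
- by apply: is_cvg_ereal_nneg_natsum_cond => n _ _; exact: nu_ge0.
- by move=> k; rewrite -[X in measurable X]setTI; exact: mphi.
- by apply/measurable_EFinP; exact: measurable_funTS.
- by move=> x _; rewrite lee_fin.
- by move=> i j _ _ [x [Ax Bx]]; apply: (tA i j) => //; exists (phi x).
Qed.

HB.instance Definition _ := isMeasure.Build _ _ _ nu nu0 nu_ge0 nu_sigma_additive.

End pushforward_density.

(** Every open ray is the union of the rational rays inside it. Countability of the generator is
    what later allows one null set for all test sets; [setT] is included to serve as the exhausting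
    sequence in the uniqueness theorem. *)
Lemma measurable_rat_rays (R : realType) :
  @measurable _ (measurableTypeR R) =
  <<s [set A | A = setT \/ exists r : rat, A = [set` `]-oo, (ratr r : R)[]] >>.
Proof.
set G := (X in <<s X >>).
rewrite [LHS]RGenInftyO.measurableE; apply/seteqP; split; apply: smallest_sub.
- exact: smallest_sigma_algebra.
- move=> _ [x ->].
  have -> : `]-oo, x[%classic =
      \bigcup_(r : rat) if ratr r < x then `]-oo, (ratr r : R)[%classic else set0.
    apply/seteqP; split => y /=; rewrite in_itv/=.
      move=> /rat_in_itvoo[r]; rewrite in_itv/= => /andP[yr rx].
      by exists r => //=; rewrite rx/= in_itv.
    by move=> [r _]; case: ifPn => //= rx; rewrite in_itv/= => /lt_trans; apply.
  apply: (@bigcupT_measurable_rat _ (g_sigma_algebraType G)) => r.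
  case: ifPn => _; last exact: measurable0.
  by apply: sub_sigma_algebra; right; exists r.
- exact: smallest_sigma_algebra.
- move=> _ [->|[r ->]].
  + exact: (@measurableT _ (g_sigma_algebraType (@RGenInftyO.G R))).
  + by apply: sub_sigma_algebra; eexists; reflexivity.
Qed.

Lemma measure_eq_rat_rays (R : realType)
    (m1 m2 : {measure set (measurableTypeR R) -> \bar R}) :
  (m1 setT < +oo)%E -> m1 setT = m2 setT ->
  (forall r : rat, m1 [set` `]-oo, (ratr r : R)[] = m2 [set` `]-oo, (ratr r : R)[]) ->
  forall A, measurable A -> m1 A = m2 A.
Proof.
move=> m1oo m12T m12 A mA.
apply: (measure_unique _ (fun=> setT) (measurable_rat_rays R)) => //.
- move=> B C [->|[r ->]] [->|[s ->]].
  + by left; rewrite setTI.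
  + by right; exists s; rewrite setTI.
  + by right; exists r; rewrite setIT.
  + right; exists (Num.min r s); apply/seteqP; split => x /=; rewrite !in_itv/=.
      by move=> [xr xs]; case: (leP r s).
    case: (leP r s) => rs xr; split => //; apply: lt_le_trans xr _.
      by rewrite ler_rat.
    by rewrite ler_rat ltW.
- by left.
- by apply/seteqP; split => // x _; exists 0%N.
- by move=> B [->|[r ->]].
Qed.

(** * Disintegration *)

Section sections.
Context d1 d2 (X : measurableType d1) (Y : measurableType d2) (R : realType)
  (m1 : {sigma_finite_measure set X -> \bar R})
  (m2 : {sigma_finite_measure set Y -> \bar R}).
Local Open Scope ereal_scope.

Lemma measurable_section (S : set (X * Y)) y : measurable S -> measurable [set x | S (x, y)].
Proof.
move=> mS; rewrite (_ : [set x | S (x, y)] = pair^~ y @^-1` S)//.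
by rewrite -[X in measurable X]setTI; apply: (measurable_pair2 y).
Qed.

Lemma measurable_fun_integral_section (S : set (X * Y)) (f : X * Y -> R) :
  measurable S -> measurable_fun setT f -> (forall u, (0 <= f u)%R) ->
  measurable_fun setT (fun y => \int[m1]_(x in [set x | S (x, y)]) (f (x, y))%:E).
Proof.
move=> mS mf f0.
under eq_fun do rewrite integral_mkcond.
apply: (measurable_fun_fubini_tonelli_G ((EFin \o f) \_ S)).
- apply/(measurable_restrictT _ mS)/measurable_EFinP; exact: measurable_funTS.
- by move=> u; rewrite patchE; case: ifPn => //= _; rewrite lee_fin.
Qed.

Lemma integral_section (S : set (X * Y)) (f : X * Y -> R) (E : set Y) :
  measurable S -> measurable_fun setT f -> (forall u, (0 <= f u)%R) -> measurable E ->
  \int[m2]_(y in E) \int[m1]_(x in [set x | S (x, y)]) (f (x, y))%:E =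
  \int[m1 \x m2]_(u in S `&` snd @^-1` E) (f u)%:E.
Proof.
move=> mS mf f0 mE.
have mE' : measurable (@snd X Y @^-1` E).
  by rewrite -[X in measurable X]setTI; exact: measurable_snd.
rewrite [RHS]integral_mkcond fubini_tonelli2; last 2 first.
- apply/(measurable_restrictT _ (measurableI _ _ mS mE'))/measurable_EFinP.
  exact: measurable_funTS.
- by move=> u; rewrite patchE; case: ifPn => //= _; rewrite lee_fin.
rewrite [LHS]integral_mkcond; apply: eq_integral => y _; rewrite patchE.
case: ifPn => yE.
  rewrite integral_mkcond; apply: eq_integral => x _; rewrite !patchE.
  rewrite (_ : ((x, y) \in _) = (x \in [set x | S (x, y)]))//.
  by apply/idP/idP; rewrite !inE/=; [case|split => //; rewrite inE in yE].
rewrite /fubini_G integral0_eq// => x _; rewrite patchE; case: ifPn => //.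
by rewrite inE => -[_ /= /mem_set]; rewrite (negbTE yE).
Qed.

(** Almost every section of the complement of [S] is null, so Tonelli with integrand 1 gives the
    complement measure 0. *)
Lemma ae_prod (S : set (X * Y)) : measurable S ->
  {ae m2, forall y, {ae m1, forall x, S (x, y)}} -> {ae m1 \x m2, forall u, S u}.
Proof.
move=> mS aeS; exists (~` S); split => //; first exact: measurableC.
have mC : measurable (~` S) by exact: measurableC.
have := @integral_section (~` S) (cst 1%R) setT mC (measurable_cst _) (fun=> ler01) measurableT.
have mu1 d (T : measurableType d) (mu : {measure set T -> \bar R}) (A : set T) :
    measurable A -> \int[mu]_(x in A) (1%R : R)%:E = mu A.
  by move=> mA; rewrite (integral_cst mu mA 1%:E) mul1e.
rewrite preimage_setT setIT mu1// => <-.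
rewrite (ae_eq_integral (cst 0)) ?integral0//.
- by apply: measurable_fun_integral_section => //; exact: measurable_cst.
- apply: filterS aeS => y [N [mN N0 NS]] _.
  rewrite mu1; last exact: measurable_section.
  by apply: subset_measure0 N0 => //; exact: measurable_section.
Qed.

End sections.

Lemma ae_forall_countable d (T : measurableType d) (R : realType) (mu : {measure set T -> \bar R})
    (I : countType) (Q : I -> T -> Prop) :
  (forall i, {ae mu, forall x, Q i x}) -> {ae mu, forall x, forall i, Q i x}.
Proof.
move=> aeQ; pose F k := if unpickle k is Some i then ~` [set x | Q i x] else set0.
have : mu.-negligible (\bigcup_k F k).
  apply: negligible_bigcup => k; rewrite /F.
  by case: unpickle => [i|]; [exact: aeQ|exact: negligible_set0].
apply: negligibleS => x /= /existsNP[i nQ].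
by exists (pickle i) => //; rewrite /F pickleK.
Qed.

Section conditional_density.
Context (R : realType) d d' (T : measurableType d) (U : measurableType d')
  (P : probability T R) (mu : {sigma_finite_measure set U -> \bar R})
  (V : T -> measurableTypeR R * U) (gam gam' : measurableTypeR R * U -> measurableTypeR R)
  (p q : measurableTypeR R * U -> R).
Local Notation lam := (@lebesgue_measure R).
Context (mV : measurable_fun setT V) (mgam : measurable_fun setT gam)
  (mgam' : measurable_fun setT gam')
  (dgam : forall x z, is_derive (x : R) (1 : R) (fun t : R => gam (t, z) : R) (gam' (x, z)))
  (hp : has_pdf (lam \x mu)%E P V p)
  (hq : has_pdf (lam \x mu)%E P (fun w => (gam (V w), (V w).2)) q).

(** Integrated over any measurable set [E] of values [z], both sides give the probability that
    [gam V] lies in [C] and the second component of [V] in [E]; functions with equal integrals over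
    all [E] agree almost everywhere. The exceptional set depends on [C]. *)
Lemma ae_integral_section_pdf (C : set (measurableTypeR R)) : measurable C ->
  {ae mu, forall z, (\int[lam]_(y in C) (q (y, z))%:E =
    \int[lam]_(x in [set x | C (gam (x, z))]) (p (x, z))%:E)%E}.
Proof.
move=> mC; have [mp p0 pE] := hp; have [mq q0 qE] := hq.
pose S1 : set (measurableTypeR R * U) := fst @^-1` C.
pose S2 : set (measurableTypeR R * U) := gam @^-1` C.
have mS1 : measurable S1 by rewrite -[X in measurable X]setTI; exact: measurable_fst.
have mS2 : measurable S2 by rewrite -[X in measurable X]setTI; exact: mgam.
have mE' (E : set U) : measurable E -> measurable (@snd (measurableTypeR R) U @^-1` E).
  by move=> mE; rewrite -[X in measurable X]setTI; exact: measurable_snd.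
pose F z := (\int[lam]_(y in [set y | S1 (y, z)]) (q (y, z))%:E)%E.
pose G z := (\int[lam]_(x in [set x | S2 (x, z)]) (p (x, z))%:E)%E.
have mF : measurable_fun setT F by exact: measurable_fun_integral_section.
have mG : measurable_fun setT G by exact: measurable_fun_integral_section.
have FE E : measurable E ->
    (\int[mu]_(z in E) F z = P (V @^-1` (S2 `&` snd @^-1` E)))%E.
  move=> mE; rewrite /F integral_section// -qE//.
  by apply: measurableI => //; exact: mE'.
have GE E : measurable E ->
    (\int[mu]_(z in E) G z = P (V @^-1` (S2 `&` snd @^-1` E)))%E.
  move=> mE; rewrite /G integral_section// -pE//.
  by apply: measurableI => //; exact: mE'.
suff : ae_eq mu setT F G by apply: filterS => z /= /(_ I).
apply: integral_ae_eq => //; last by move=> E _ mE; rewrite FE ?GE.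
(* Integrability of [F]: it is nonnegative and its total integral is a probability. *)
apply/integrableP; split => //.
have F0 z : (0 <= F z)%E by apply: integral_ge0 => y _; rewrite lee_fin.
under eq_integral do rewrite gee0_abs//.
rewrite FE//; apply: le_lt_trans (ltry 1); apply: probability_le1.
rewrite -[X in measurable X]setTI; apply: mV => //.
by apply: measurableI => //; exact: mE'.
Qed.

Lemma ae_integrable_section (f : measurableTypeR R * U -> R) (Z : T -> measurableTypeR R * U) :
  has_pdf (lam \x mu)%E P Z f ->
  {ae mu, forall z, lam.-integrable setT (fun x => (f (x, z))%:E)}.
Proof.
move=> [mf f0 fE]; apply: (@ae_integrable2 _ _ _ _ _ lam mu (EFin \o f)).
apply/integrableP; split; first exact/measurable_EFinP.
under eq_integral do rewrite gee0_abs ?lee_fin//.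
by rewrite -fE// preimage_setT probability_setT ltry.
Qed.

(** The one-variable comparison is applied on almost every section [z] and the sections are
    reassembled by Tonelli; [V] then avoids the exceptional null set almost surely. *)
Lemma ae_pdf_le_pullback :
  {ae P, forall w, p (V w) <= q (gam (V w), (V w).2) * `|gam' (V w)|}.
Proof.
have [mp p0 pE] := hp; have [mq q0 qE] := hq.
apply: (ae_pdf mV hp (Q := fun u => p u <= q (gam u, u.2) * `|gam' u|)).
have aeT := ae_integral_section_pdf measurableT.
(* Restricting to rational rays leaves a countable union of exceptional sets; for the remaining [z]
   the equality extends to every Borel set by uniqueness of measures. *)
have aer : {ae mu, forall z, forall r : rat,
    (\int[lam]_(y in [set` `]-oo, (ratr r : R)[]) (q (y, z))%:E =
    \int[lam]_(x in [set x | [set` `]-oo, (ratr r : R)[] (gam (x, z))]) (p (x, z))%:E)%E}.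
  apply: ae_forall_countable => r; apply: ae_integral_section_pdf.
  exact: measurable_itv.
have aep := ae_integrable_section hp.
have aeq := ae_integrable_section hq.
have : {ae mu, forall z, {ae lam, forall x, p (x, z) <= q (gam (x, z), z) * `|gam' (x, z)|}}.
  apply: filterS2 (filterI aeT aer) (filterI aep aeq) => z [zT zr] [zp zq].
  have mpz : measurable_fun setT (fun x => p (x, z)) by exact: measurableT_comp.
  have mqz : measurable_fun setT (fun x => q (x, z)) by exact: measurableT_comp.
  have mgz : measurable_fun setT (fun x => gam (x, z)) by exact: measurableT_comp.
  apply: (@density_le_pullback R (fun x => gam (x, z)) (fun x => gam' (x, z))
    (fun x => p (x, z)) (fun x => q (x, z))) => //.
  have p0z x : 0 <= p (x, z) by [].
  have q0z x : 0 <= q (x, z) by [].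
  have mid : measurable_fun setT (@id (measurableTypeR R)) by exact: measurable_id.
  move=> C mC.
  have := @measure_eq_rat_rays R (pushforward_density lam mqz q0z mid)
    (pushforward_density lam mpz p0z mgz).
  apply => //.
  have /integrableP[_] := zq.
  by under eq_integral do rewrite gee0_abs ?lee_fin//.
have mS : measurable [set u | p u <= q (gam u, u.2) * `|gam' u|].
  rewrite -[X in measurable X]setTI; apply: measurable_fun_le => //.
  apply: measurable_funM; last exact: measurableT_comp.
  by apply: measurableT_comp => //; apply/measurable_fun_pair.
by move=> aeS; have := ae_prod mS aeS; apply: filterS => u pu _.
Qed.

End conditional_density.

(** Inversion is continuous off 0, and any function is measurable on the singleton of 0. *)
Lemma measurable_invr (R : realType) : measurable_fun setT (@GRing.inv R).
Proof.
have m0 : measurable ([set 0] : set (measurableTypeR R)) by exact: measurable_set1.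
rewrite -(setUv ([set 0] : set R)); apply/measurable_funU => //; first exact: measurableC.
split; first exact: measurable_fun_set1.
apply: open_continuous_measurable_fun; first exact/closed_openC/closed_eq.
by move=> x; rewrite inE/= => /eqP x0; exact: inv_continuous.
Qed.

(** * Entropies *)

Lemma integrable_fubini_snd d1 d2 (X : measurableType d1) (Y : measurableType d2) (R : realType)
    (m1 : {sigma_finite_measure set X -> \bar R}) (m2 : {sigma_finite_measure set Y -> \bar R})
    (f : X * Y -> \bar R) :
  (m1 \x m2)%E.-integrable setT f -> m2.-integrable setT (fubini_G m1 f).
Proof.
move=> /[dup] /measurable_int mf fi.
have mG := measurable_fubini_G fi.
apply/integrableP; split => //.
apply: le_lt_trans ((integrable21ltyP m1 m2 mf).1 fi).
apply: ge0_le_integral => //; first exact: measurableT_comp.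
- apply: (measurable_fun_fubini_tonelli_G (abse \o f)) => //=.
  exact: measurableT_comp.
- by move=> y _; apply: le_abse_integral => //; exact: measurableT_comp.
Qed.

Lemma ae_eq_integrable d (T : measurableType d) (R : realType) (mu : {measure set T -> \bar R})
    (f g : T -> \bar R) :
  measurable_fun setT g -> mu.-integrable setT f -> ae_eq mu setT f g ->
  mu.-integrable setT g.
Proof.
move=> mg /[dup] /measurable_int mf /integrableP[_ foo] fg.
apply/integrableP; split => //; rewrite (ae_eq_integral (abse \o f))//.
- exact: measurableT_comp.
- exact: measurableT_comp.
- by apply: filterS fg => x /[apply] /= ->.
Qed.

(** Tonelli gives measurability for the positive and negative parts; their difference makes sense at
    every [y], including those where the section is not integrable. *)
Lemma measurable_fun_integral_section_real d1 d2 (X : measurableType d1) (Y : measurableType d2)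
    (R : realType) (m1 : {sigma_finite_measure set X -> \bar R}) (f : X * Y -> R) :
  measurable_fun setT f -> measurable_fun setT (fun y => \int[m1]_x (f (x, y))%:E)%E.
Proof.
move=> mf; have mfE : measurable_fun setT (EFin \o f) by exact/measurable_EFinP.
under eq_fun => y.
  rewrite integralE (eq_integral _ _ (fun x _ => funeposE _ x)).
  rewrite (eq_integral _ _ (fun x _ => funenegE _ x)).
  over.
apply: emeasurable_funB.
- apply: (measurable_fun_fubini_tonelli_G (fun u => maxe (f u)%:E 0)).
  + exact: measurable_maxe.
  + by move=> u; rewrite le_max lexx orbT.
- apply: (measurable_fun_fubini_tonelli_G (fun u => maxe (- (f u)%:E)%E 0)).
  + by apply: measurable_maxe => //; apply: measurableT_comp mfE; exact: oppe_measurable.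
  + by move=> u; rewrite le_max lexx orbT.
Qed.

Lemma integrable_pdfP d d' (T : measurableType d) (U : measurableType d') (R : realType)
    (mu : {measure set U -> \bar R}) (P : probability T R) (Z : T -> U) (f : U -> R)
    (phi : U -> R) :
  measurable_fun setT Z -> has_pdf mu P Z f -> measurable_fun setT phi ->
  P.-integrable setT (fun w => (phi (Z w))%:E) ->
  mu.-integrable setT (fun u => (phi u * f u)%:E).
Proof.
move=> mZ fZ mphi /integrableP[_ iphi]; have [mf f0 _] := fZ.
apply/integrableP; split; first by apply/measurable_EFinP; exact: measurable_funM.
under eq_integral do rewrite EFinM abseM (@gee0_abs _ (f _)%:E) ?lee_fin//.
rewrite -(ge0_integral_pdf mZ fZ (phi := fun u => `|phi u|%:E))//.
exact/measurable_EFinP/measurableT_comp.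
Qed.

Section conditional_entropy.
Context (R : realType) d d' (T : measurableType d) (U : measurableType d')
  (P : probability T R) (mu : {sigma_finite_measure set U -> \bar R})
  (Y : T -> measurableTypeR R) (Z : T -> U)
  (q : measurableTypeR R * U -> R) (fZ : U -> R).
Local Notation lam := (@lebesgue_measure R).
Let W w := (Y w, Z w).
Context (mY : measurable_fun setT Y) (mZ : measurable_fun setT Z)
  (hq : has_pdf (lam \x mu)%E P W q) (hZ : has_pdf mu P Z fZ)
  (eYZ : finite_entropy (lam \x mu)%E q) (eZ : finite_entropy mu fZ).

Let mW : measurable_fun setT W. Proof. exact/measurable_fun_pair. Qed.

(** The conditional density, viewed as a function of the pair. *)
Let c (u : measurableTypeR R * U) : R := q u / fZ u.2.

Let mc : measurable_fun setT c.
Proof.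
have [mq _ _] := hq; have [mf _ _] := hZ.
apply: measurable_funM => //; apply: (measurableT_comp (@measurable_invr R)).
exact: measurableT_comp.
Qed.

Let mlc : measurable_fun setT (@ln R \o c).
Proof. exact: measurableT_comp mc. Qed.

(** Almost surely [q] and [fZ] are both positive along [(Y, Z)], so the logarithm of the quotient
    splits into two integrable terms. *)
Let integrable_ln_c : P.-integrable setT (fun w => (ln (c (W w)))%:E) /\
  (\int[P]_w (ln (c (W w)))%:E =
   (diff_entropy mu fZ - diff_entropy (lam \x mu)%E q)%:E)%E.
Proof.
have [iq qE] := finite_entropy_pdf mW hq eYZ.
have [iZ ZE] := finite_entropy_pdf mZ hZ eZ.
have aeE : ae_eq P setT (fun w => (ln (c (W w)))%:E)
    (fun w => (ln (q (W w)))%:E - (ln (fZ (Z w)))%:E)%E.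
  apply: filterS2 (ae_pdf_gt0 mW hq) (ae_pdf_gt0 mZ hZ) => w qw fw _.
  by rewrite /c ln_div ?posrE// EFinB.
have mL : measurable_fun setT (fun w => (ln (c (W w)))%:E).
  exact/measurable_EFinP/(measurableT_comp mlc mW).
have iB := integrableB measurableT iq iZ.
split; first by apply: ae_eq_integrable mL iB _; exact: ae_eq_sym.
rewrite (ae_eq_integral _ _ measurableT mL (measurable_int _ iB) aeE).
by rewrite integralB//= qE ZE -EFinN -EFinD (opprK (diff_entropy mu fZ)) addrC.
Qed.

(** Chain rule for entropy. Since [q] is [c] times [fZ] wherever [fZ] is nonzero, averaging the
    inner integrals of [c ln c] over [Z] is an iterated integral of [q ln c], that is,
    [E[ln c(Y, Z)]]. *)
Lemma cond_entropyE :
  cond_entropy P Z q fZ = diff_entropy (lam \x mu)%E q - diff_entropy mu fZ.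
Proof.
have [mq q0 qE] := hq; have [mf f0 fE] := hZ.
have [iL LE] := integrable_ln_c.
(* Integrability is moved from the probability space to the product measure, where Fubini
   applies. *)
have ipsi := integrable_pdfP mW hq mlc iL.
have [_ psiE] := integrable_pdf mW hq mlc ipsi.
pose K z := (\int[lam]_y (c (y, z) * ln (c (y, z)))%:E)%E.
have mK : measurable_fun setT K.
  apply: (measurable_fun_integral_section_real lam (f := fun u => c u * ln (c u))).
  exact: measurable_funM.
have HK z : diff_entropy lam (cond_pdf q fZ z) = - fine (K z).
  congr (- fine _); rewrite integral_mkcond; apply: eq_integral => y _.
  rewrite patchE /cond_pdf -/(c (y, z)); case: ifPn => //.
  rewrite notin_setE/= => /negP; rewrite -leNgt => c0.
  have -> : c (y, z) = 0 by apply/eqP; rewrite eq_le c0 divr_ge0.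
  by rewrite mul0r.
pose G := fubini_G lam (fun u => (ln (c u) * q u)%:E).
have iG : mu.-integrable setT G by exact: integrable_fubini_snd.
have KG : {ae mu, forall z, (fine (K z) * fZ z)%:E = G z}.
  have := ae_integrable2 ipsi.
  apply: filterS2 (integrable_ae measurableT iG) => z /(_ I) Gz iz.
  (* where fZ vanishes, c = 0 because x / 0 = 0, and ln 0 = 0 *)
  have [fz0|fz0] := eqVneq (fZ z) 0.
    rewrite fz0 mulr0 /G /fubini_G integral0_eq// => y _.
    by rewrite /c/= fz0 invr0 mulr0 ln0// mul0r.
  have -> : K z = ((fZ z)^-1%:E * G z)%E.
    rewrite /G /fubini_G -integralZl//; apply: eq_integral => y _.
    by rewrite -EFinM {1}/c/= (mulrC (q _)) -mulrA (mulrC (q _)).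
  by rewrite fineM//= mulrAC mulVf// mul1r fineK.
rewrite /cond_entropy unlock.
under eq_integral do rewrite HK.
have mfK : measurable_fun setT (fun z => - fine (K z)).
  by apply: measurable_funN; exact: measurableT_comp.
have iKf : mu.-integrable setT (fun z => (- fine (K z) * fZ z)%:E).
  apply: ae_eq_integrable (integrableN iG) _.
    by apply/measurable_EFinP/measurable_funM.
  by apply: filterS KG => z Kz _; rewrite mulNr EFinN Kz.
have [_ ->] := integrable_pdf mZ hZ mfK iKf.
transitivity (- fine (\int[mu]_z G z)).
  rewrite -fineN; congr (fine _); rewrite -integralN//=; last exact: integrable_add_def.
  apply: ae_eq_integral => //.
  - exact: measurable_int iKf.
  - exact: measurable_int (integrableN iG).
  - by apply: filterS KG => z Kz _; rewrite mulNr EFinN Kz.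
(* Fubini returns to [E[ln c(Y, Z)]], which equals [H(Z) - H(Y, Z)]. *)
by rewrite integral21_prod_meas1// -psiE LE opprB.
Qed.

End conditional_entropy.

(** Replacing [f] by the minimum of [f] and [g] changes it on a null set only and makes the
    inequality hold everywhere. *)
Lemma ae_le_integral d (T : measurableType d) (R : realType) (mu : {measure set T -> \bar R})
    (f g : T -> \bar R) :
  mu.-integrable setT f -> mu.-integrable setT g ->
  {ae mu, forall x, (f x <= g x)%E} -> (\int[mu]_x f x <= \int[mu]_x g x)%E.
Proof.
move=> fi gi fg; have mf := measurable_int _ fi; have mg := measurable_int _ gi.
have mm : measurable_fun setT (fun x => mine (f x) (g x)) by exact: measurable_mine.
have ae : ae_eq mu setT f (fun x => mine (f x) (g x)).
  by apply: filterS fg => x fgx _; rewrite min_l.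
rewrite (ae_eq_integral _ _ measurableT mf mm ae).
apply: le_integral => //; first exact: ae_eq_integrable ae.
by move=> x _; rewrite ge_min lexx orbT.
Qed.

(** * Gibbs' inequality and the bound on the total effect entropy *)

Section entropy_inequality.
Context (R : realType) d d' (T : measurableType d) (U : measurableType d')
  (P : probability T R) (mu : {sigma_finite_measure set U -> \bar R})
  (X : T -> measurableTypeR R) (Z : T -> U)
  (gam gam' : measurableTypeR R * U -> measurableTypeR R)
  (p q : measurableTypeR R * U -> R) (fX : measurableTypeR R -> R) (fZ : U -> R).
Local Notation lam := (@lebesgue_measure R).
Let V w := (X w, Z w).
Let W w := (gam (V w), Z w).
Context (mX : measurable_fun setT X) (mZ : measurable_fun setT Z)
  (mgam : measurable_fun setT gam) (mgam' : measurable_fun setT gam')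
  (dgam : forall x z, is_derive (x : R) (1 : R) (fun t : R => gam (t, z) : R) (gam' (x, z)))
  (hp : has_pdf (lam \x mu)%E P V p)
  (hq : has_pdf (lam \x mu)%E P W q)
  (hX : has_pdf lam P X fX) (hZ : has_pdf mu P Z fZ)
  (eYZ : finite_entropy (lam \x mu)%E q) (eX : finite_entropy lam fX)
  (eZ : finite_entropy mu fZ).

Let mV : measurable_fun setT V. Proof. exact/measurable_fun_pair. Qed.
Let mW : measurable_fun setT W.
Proof. by apply/measurable_fun_pair => //; exact: measurableT_comp. Qed.

(** The likelihood ratio of the product of the marginals to the joint law; it carries the dependence
    between [X] and [Z]. *)
Let r (u : measurableTypeR R * U) : R := fX u.1 * fZ u.2 / p u.

Let mXZ : measurable_fun setT (fun u : measurableTypeR R * U => fX u.1 * fZ u.2).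
Proof.
have [mfX _ _] := hX; have [mfZ _ _] := hZ.
by apply: measurable_funM; exact: measurableT_comp.
Qed.

Let mr : measurable_fun setT r.
Proof.
have [mp _ _] := hp.
apply: measurable_funM => //; exact: (measurableT_comp (@measurable_invr R)).
Qed.

Let r_ge0 u : 0 <= r u.
Proof.
have [_ ? _] := hX; have [_ ? _] := hZ; have [_ ? _] := hp.
by rewrite divr_ge0// mulr_ge0.
Qed.

(** The expectation is the integral of [r * p], which is at most that of the product of the two
    marginal densities, namely 1. Equality may fail because [r * p] is 0 where [p] vanishes. *)
Let integral_r_le1 : (\int[P]_w (r (V w))%:E <= 1)%E.
Proof.
have [mp p0 _] := hp; have [mfX fX0 XE] := hX; have [mfZ fZ0 ZE] := hZ.
rewrite (ge0_integral_pdf mV hp (phi := EFin \o r))//; last exact/measurable_EFinP.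
apply: (@le_trans _ _ (\int[lam \x mu]_u (fX u.1 * fZ u.2)%:E)%E).
  apply: ge0_le_integral => //=.
  - by move=> u _; rewrite mule_ge0 ?lee_fin.
  - by apply: emeasurable_funM; exact/measurable_EFinP.
  - exact/measurable_EFinP.
  - move=> u _; rewrite -EFinM lee_fin /r.
    have [->|pu] := eqVneq (p u) 0; first by rewrite mulr0 mulr_ge0.
    by rewrite divfK.
rewrite fubini_tonelli2/=; last 2 first.
- exact/measurable_EFinP.
- by move=> u; rewrite lee_fin mulr_ge0.
rewrite /fubini_G/=.
have fX1 : (\int[lam]_x (fX x)%:E = 1)%E by rewrite -XE// preimage_setT probability_setT.
have fZ1 : (\int[mu]_z (fZ z)%:E = 1)%E by rewrite -ZE// preimage_setT probability_setT.
under eq_integral => z _.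
  under eq_integral do rewrite EFinM.
  rewrite ge0_integralZr//; last 3 first.
  - exact/measurable_EFinP.
  - by move=> x _; rewrite lee_fin.
  - by rewrite lee_fin.
  rewrite fX1 mul1e; over.
by rewrite fZ1.
Qed.

Lemma total_entropy_le :
  {ae P, forall w, gam' (V w) != 0} ->
  P.-integrable setT (fun w => (ln `|gam' (V w)|)%:E) ->
  ((diff_entropy (lam \x mu)%E q - diff_entropy mu fZ)%:E <=
   (diff_entropy lam fX)%:E + \int[P]_w (ln `|gam' (V w)|)%:E)%E.
Proof.
move=> g0 ig; have [mp p0 _] := hp; have [mfX fX0 XE] := hX; have [mfZ fZ0 ZE] := hZ.
have [_ q0 _] := hq.
have [iq qE] := finite_entropy_pdf mW hq eYZ.
have [iX HX] := finite_entropy_pdf mX hX eX.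
have [iZ HZ] := finite_entropy_pdf mZ hZ eZ.
have ir : P.-integrable setT (fun w => (r (V w))%:E).
  apply/integrableP; split; first exact/measurable_EFinP/(measurableT_comp mr).
  under eq_integral do rewrite gee0_abs ?lee_fin//.
  exact: le_lt_trans integral_r_le1 (ltry _).
have i1 : P.-integrable setT (fun=> 1%:E) by exact: finite_measure_integrable_cst.
have iM := integrableB measurableT ir i1.
have iXZ := integrableD measurableT iX iZ.
have iqg := integrableD measurableT iq ig.
have iL := integrableB measurableT iXZ iqg.
have : {ae P, forall w, ((ln (fX (X w)))%:E + (ln (fZ (Z w)))%:E -
    ((ln (q (W w)))%:E + (ln `|gam' (V w)|)%:E) <= (r (V w))%:E - 1%:E)%E}.
  apply: filterS2 (filterI (ae_pdf_le_pullback mV mgam mgam' dgam hp hq) (ae_pdf_gt0 mV hp))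
    (filterI g0 (filterI (ae_pdf_gt0 mX hX) (ae_pdf_gt0 mZ hZ))).
  move=> w [pq pw] [gw [xw zw]].
  have gw0 : 0 < `|gam' (V w)| by rewrite normr_gt0.
  (* A zero of [q] would force [p (V w) <= 0] through the pullback inequality. *)
  have qw : 0 < q (W w).
    rewrite lt_neqAle q0 andbT eq_sym; apply/eqP => qw.
    by move: pq; rewrite -/(W w) qw mul0r leNgt pw.
  rewrite -!EFinD lee_fin.
  apply: (@le_trans _ _ (ln (r (V w)))); last first.
    have rw : 0 < r (V w) by rewrite divr_gt0 ?mulr_gt0.
    (* [ln r <= r - 1], from [ln (1 + x) <= x] at [x = r - 1]. *)
    have := @le_ln1Dx R (r (V w) - 1); rewrite ltrBrDl subrr (addrC 1) subrK.
    exact.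
  rewrite /r ln_div ?lnM ?posrE ?mulr_gt0//=.
  (* Once the marginal terms cancel, what is left is the logarithm of [p <= q |gam'|]. *)
  rewrite lerD2l lerN2 -lnM ?posrE//.
  by rewrite ler_ln ?posrE ?mulr_gt0.
move=> /(ae_le_integral iL iM); rewrite !integralB//= !integralD//= HX HZ qE.
have -> : (\int[P]_w 1%:E = 1)%E.
  exact: (etrans (integral_cst P measurableT (1%:E : \bar R))
    (etrans (mul1e _) (probability_setT P))).
have /fineK <- := integrable_fin_num measurableT ig.
(* The right-hand side is [E[r] - 1], hence at most 0. *)
move=> H; have {H} := le_trans H (leeB integral_r_le1 (le_refl 1%E)).
rewrite subee// -!EFinD !lee_fin.
set h1 := diff_entropy _ _; set h2 := diff_entropy _ _; set h3 := diff_entropy _ _.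
lra.
Qed.

End entropy_inequality.

(** * Coordinates of tuples *)

Lemma measurable_box (R : realType) n (B : 'I_n -> set (measurableTypeR R)) :
  (forall j, measurable (B j)) ->
  measurable [set t : n.-tuple (measurableTypeR R) | forall j, B j (tnth t j)].
Proof.
move=> mB; rewrite (_ : mkset _ =
    \bigcap_(j in [set: 'I_n]) ((@tnth _ (measurableTypeR R))^~ j @^-1` B j)).
  apply: fin_bigcap_measurable; first exact: finite_finset.
  move=> j _; rewrite -[X in measurable X]setTI.
  exact: (measurable_tnth j).
by apply/seteqP; split => t /= tB j; [move=> _|]; exact: tB.
Qed.

Section insert_coordinate.
Context (R : realType) (n : nat) (i : 'I_n.+1).
Local Notation M := (measurableTypeR R).
Local Notation lam := (@lebesgue_measure R).

(** Two-sided inverse of the splitting [t |-> (tnth t i, drop_coord i t)]. *)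
Definition insert_coord (u : M * n.-tuple M) : n.+1.-tuple M :=
  [tuple if unlift i j is Some k then tnth u.2 k else u.1 | j < n.+1].

Lemma tnth_insert_coord u : tnth (insert_coord u) i = u.1.
Proof. by rewrite tnth_mktuple unlift_none. Qed.

Lemma tnth_insert_coord_lift u (k : 'I_n) : tnth (insert_coord u) (lift i k) = tnth u.2 k.
Proof. by rewrite tnth_mktuple liftK. Qed.

Lemma insert_coordK (t : n.+1.-tuple M) :
  insert_coord (tnth t i, drop_coord i t) = t.
Proof.
apply: eq_from_tnth => j; have [k ->|->] := unliftP i j.
  by rewrite tnth_insert_coord_lift/= tnth_mktuple.
by rewrite tnth_insert_coord.
Qed.

Lemma drop_coord_insert u : drop_coord i (insert_coord u) = u.2.
Proof. by apply: eq_from_tnth => k; rewrite tnth_mktuple tnth_insert_coord_lift. Qed.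

Lemma measurable_insert_coord : measurable_fun setT insert_coord.
Proof.
apply/measurable_fun_tnthP => j; rewrite /comp/=.
under eq_fun do rewrite tnth_mktuple.
case: unlift => [k|]; last exact: measurable_fst.
by apply: (measurableT_comp (measurable_tnth k)); exact: measurable_snd.
Qed.

Lemma measurable_drop_coord : measurable_fun setT (@drop_coord M n.+1 i).
Proof.
apply/measurable_fun_tnthP => j; rewrite /comp/=.
by under eq_fun do rewrite tnth_mktuple; exact: measurable_tnth.
Qed.

Definition boxes := [set A : set (n.+1.-tuple M) | exists B : 'I_n.+1 -> set M,
  (forall j, measurable (B j)) /\ A = [set t | forall j, B j (tnth t j)]].

Lemma measurable_boxes : @measurable _ (n.+1.-tuple M) = <<s boxes >>.
Proof.
apply/seteqP; split; apply: smallest_sub.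
- exact: smallest_sigma_algebra.
- move=> A; rewrite -bigcup_mkord_ord => -[j _ [B mB <-]].
  (* A cylinder over one coordinate is a box whose other sides are the whole line. *)
  apply: sub_sigma_algebra; exists (fun k => if k == inord j then B else setT); split.
    by move=> k; case: ifPn.
  apply/seteqP; split => t /=.
    by move=> [_ Bt] k; case: eqP => // ->.
  by move=> /(_ (inord j)); rewrite eqxx.
- exact: sigma_algebra_measurable.
- by move=> _ [B [mB ->]]; exact: measurable_box.
Qed.

(** [lebesgue_tuple] splits off coordinate 0 by construction; here coordinate [i] is split off
    instead. The two measures agree on boxes, a generating family closed under intersection, and the
    cubes [g k] of finite measure exhaust the space. *)
Lemma lebesgue_tuple_insert (A : set (n.+1.-tuple M)) : measurable A ->
  lebesgue_tuple n.+1 A = (lam \x lebesgue_tuple n)%E (insert_coord @^-1` A).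
Proof.
pose D k (j : 'I_n.+1) : set M := ball (0 : R) k.+1%:R.
pose g k := [set t : n.+1.-tuple M | forall j, D k j (tnth t j)].
have mD k j : measurable (D k j) by exact: measurable_ball.
pose ins : {mfun _ >-> _} := HB.pack insert_coord
  (isMeasurableFun.Build _ _ _ _ _ measurable_insert_coord).
apply: (measure_unique boxes g measurable_boxes _ _ _ _
  (pushforward (lam \x lebesgue_tuple n)%E ins)).
- move=> _ _ [B [mB ->]] [C [mC ->]]; exists (fun j => B j `&` C j); split.
    by move=> j; exact: measurableI.
  apply/seteqP; split => t /=; first by move=> [tB tC] j; split.
  by move=> tBC; split => j; have [] := tBC j.
- by move=> k; exists (D k).
- apply/seteqP; split => // t _.
  pose m := \big[Num.max/0]_(j < n.+1) `|tnth t j|.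
  exists (Num.truncn m) => // j; rewrite /D /ball/= sub0r normrN.
  apply: (@le_lt_trans _ _ m); first exact: le_bigmax.
  by rewrite truncnS_gt.
- move=> _ [B [mB ->]].
  rewrite [LHS]lebesgue_tuple_box// (bigD1_ord i)//=.
  rewrite -lebesgue_tuple_box// /pushforward -product_measure1E//; last first.
    exact: (measurable_box (fun k => mB (lift i k))).
  congr (_ _); apply/seteqP; split => -[x z]/=.
    move=> [Bx Bz] j; have [k ->|->] := unliftP i j.
      by rewrite tnth_insert_coord_lift; exact: Bz.
    by rewrite tnth_insert_coord.
  move=> Bu; split; first by have := Bu i; rewrite tnth_insert_coord.
  by move=> k; have := Bu (lift i k); rewrite tnth_insert_coord_lift.
- move=> k; rewrite -ge0_fin_numE ?measure_ge0//.
  have : (\prod_(j < n.+1) lam (D k j))%E \is a fin_num.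
    apply: (big_ind (fun x => x \is a fin_num)) => //; first exact: fin_numM.
    by move=> j _; rewrite /D lebesgue_measure_ball.
  by rewrite -lebesgue_tuple_box.
Qed.

(** Moving coordinate [i] to the front preserves Lebesgue measure, so the density is merely
    recomposed, without a Jacobian factor. *)
Lemma has_pdf_split d (T : measurableType d) (P : probability T R) (X : T -> n.+1.-tuple M)
    (f : n.+1.-tuple M -> R) :
  has_pdf (lebesgue_tuple n.+1) P X f ->
  has_pdf (lam \x lebesgue_tuple n)%E P (fun w => (tnth (X w) i, drop_coord i (X w)))
    (f \o insert_coord).
Proof.
move=> [mf f0 fE]; split; [exact: measurableT_comp measurable_insert_coord|by move=> u /=|].
move=> A mA.
pose s t : M * n.-tuple M := (tnth t i, drop_coord i t).
have ms : measurable_fun setT s.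
  by apply/measurable_fun_pair; [exact: measurable_tnth|exact: measurable_drop_coord].
have msA : measurable (s @^-1` A) by rewrite -[X in measurable X]setTI; exact: ms.
rewrite -[LHS]/(P (X @^-1` (s @^-1` A))) fE//.
pose ins : {mfun _ >-> _} := HB.pack insert_coord
  (isMeasurableFun.Build _ _ _ _ _ measurable_insert_coord).
transitivity (\int[pushforward (lam \x lebesgue_tuple n) ins]_(t in s @^-1` A) (f t)%:E)%E.
  apply: eq_measure_integral => B mB _; exact: lebesgue_tuple_insert.
rewrite ge0_integral_pushforward//=; last 3 first.
- exact: measurable_insert_coord.
- exact/measurable_EFinP/measurable_funTS.
- by move=> t _; rewrite lee_fin.
congr (integral _ _ _); apply/seteqP; split => -[x z] /=;
  by rewrite /s tnth_insert_coord drop_coord_insert.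
Qed.

End insert_coordinate.

(** * Measurability of continuous functions of a row vector *)

Section continuous_of_tuple.
Context (R : realType) (n : nat).
Local Notation M := (measurableTypeR R).

(* Rounding down to the grid (1/(k+1)) Z^n gives a countable range, hence
   measurability of g \o grid k for arbitrary g. *)
Let grid k (t : n.-tuple M) : 'rV[R]_n :=
  \row_j ((Num.floor (tnth t j * k.+1%:R))%:~R / k.+1%:R).

Let cvg_grid t : grid k t @[k --> \oo] --> row_of_tuple t.
Proof.
apply/cvg_ballP => e e0.
have /cvgr0Pnorm_lt/(_ _ e0) : @GRing.inv R k.+1%:R @[k --> \oo] --> 0 by exact: cvg_harmonic.
apply: filterS => k ke; split => // i j.
rewrite !mxE /ball/=.
have k0 : 0 < k.+1%:R :> R by [].
have /andP[f1 f2] := floor_itv (tnth t j * k.+1%:R).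
rewrite -ler_pdivrMr// in f1; rewrite -ltr_pdivlMr// in f2.
rewrite ger0_norm ?subr_ge0//; apply: lt_trans ke.
by rewrite ltrBlDl ger0_norm ?invr_ge0//; move: f2; rewrite intrD mulrDl mul1r.
Qed.

Let measurable_grid (g : 'rV[R]_n -> R) k : measurable_fun setT (g \o grid k).
Proof.
move=> _ Y mY; rewrite setTI.
pose pt (v : {ffun 'I_n -> int}) : 'rV[R]_n := \row_j ((v j)%:~R / k.+1%:R).
pose B (v : {ffun 'I_n -> int}) j := [set x : M | Num.floor (x * k.+1%:R) = v j].
(* The grid cell indexed by [v], kept exactly when [g] sends its corner into [Y]; the preimage is
   the union of these countably many boxes. *)
pose F (v : {ffun 'I_n -> int}) := if `[< Y (g (pt v)) >] then
  [set t : n.-tuple M | forall j, B v j (tnth t j)] else set0.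
rewrite (_ : _ @^-1` Y = \bigcup_v F v).
  apply: countable_bigcupT_measurable => [|v]; first exact: countableP.
  rewrite /F; case: ifPn => // _; apply: (measurable_box (B := B v)) => j.
  rewrite (_ : B v j = `[(v j)%:~R / k.+1%:R, (v j + 1)%:~R / k.+1%:R[%classic).
    exact: measurable_itv.
  apply/seteqP; split => x /=; rewrite in_itv/= ler_pdivrMr// ltr_pdivlMr//.
    by move=> <-; exact: floor_itv.
  exact: floor_def.
apply/seteqP; split => t /=.
  move=> Yt; exists [ffun j => Num.floor (tnth t j * k.+1%:R)] => //.
  rewrite /F (_ : pt _ = grid k t); last by apply/rowP => j; rewrite !mxE ffunE.
  by rewrite (asboolT Yt) => j; rewrite /B/= ffunE.
move=> [v _]; rewrite /F; case: asboolP => // Yv tv.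
by rewrite (_ : grid k t = pt v)//; apply/rowP => j; rewrite !mxE tv.
Qed.

Lemma continuous_measurable_row (g : 'rV[R]_n -> R) :
  continuous g -> measurable_fun setT (fun t : n.-tuple M => g (row_of_tuple t)).
Proof.
move=> cg; apply: (measurable_fun_cvg (h := fun k => g \o grid k)).
  by move=> k; exact: measurable_grid.
by move=> t _; apply: (cvg_comp _ _ (cvg_grid (t := t))); exact: cg.
Qed.

End continuous_of_tuple.

(** * Partial derivatives as one-variable derivatives *)

Section partial_derivative.
Context (R : realType) (n : nat) (i : 'I_n.+1) (g : 'rV[R]_n.+1 -> R).
Local Notation M := (measurableTypeR R).
Context (dg : forall x, differentiable g x).

Definition along (u : M * n.-tuple M) : R := g (row_of_tuple (insert_coord i u)).

Let row_insert (h x : R) z : row_of_tuple (insert_coord i (h + x, z)) =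
  h *: delta_mx 0 i + row_of_tuple (insert_coord i (x, z)).
Proof.
apply/rowP => j; rewrite !mxE eqxx/=; have [k ->|->] := unliftP i j.
  by rewrite !tnth_insert_coord_lift/= eq_sym (negbTE (neq_lift _ _)) mulr0 add0r.
by rewrite !tnth_insert_coord/= eqxx mulr1.
Qed.

Lemma is_derive_along (x : R) z : is_derive x (1 : R) (fun t : R => along (t, z))
  (partial g i (row_of_tuple (insert_coord i (x, z)))).
Proof.
set a := row_of_tuple _.
(* Moving the inserted coordinate by [h] translates the row by [h] times the basis vector, so the
   two difference quotients are the same function of [h]. *)
have E : (fun h : R => h^-1 *:
      (((fun t : R => along (t, z)) \o shift x) (h *: (1 : R)) - along (x, z))) =
    (fun h : R => h^-1 *: ((g \o shift a) (h *: delta_mx 0 i) - g a)).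
  by apply/funext => h; rewrite /= /along {1}[h *: _]mulr1 row_insert.
have Da : derivable g a (delta_mx 0 i) by exact: diff_derivable.
by split; rewrite /partial /derivable /derive E.
Qed.

Lemma measurable_along : measurable_fun setT (along : M * n.-tuple M -> M).
Proof.
have cg : continuous g by move=> x; exact: differentiable_continuous.
exact: (measurableT_comp (continuous_measurable_row cg) (measurable_insert_coord i)).
Qed.

(** Pointwise limit of difference quotients with step [1 / (k + 1)], each measurable. *)
Lemma measurable_partial : measurable_fun setT
  (fun u : M * n.-tuple M => partial g i (row_of_tuple (insert_coord i u))).
Proof.
pose h k (u : M * n.-tuple M) : R := k.+1%:R * (along (k.+1%:R^-1 + u.1, u.2) - along u).
apply: (measurable_fun_cvg (h := h)).
  move=> k; apply: measurable_funM => //; apply: measurable_funB; last exact: measurable_along.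
  apply: (measurableT_comp measurable_along).
  by apply/measurable_fun_pair => //; exact: measurable_funD.
move=> [x z] _; have [d1 d2] := is_derive_along x z.
rewrite -{}d2.
have /cvgr_dnbhsP/(_ (fun k => k.+1%:R^-1)) : h^-1 *: (along (h *: (1 : R) + x, z) - along (x, z))
  @[h --> 0^'] --> 'D_1 (fun t : R => along (t, z)) x by exact: d1.
have /[swap]/[apply] : (forall k, k.+1%:R^-1 != 0 :> R) /\ k.+1%:R^-1 @[k --> \oo] --> (0 : R).
  by split; [move=> k; rewrite invr_eq0 pnatr_eq0|exact: cvg_harmonic].
by under eq_fun do rewrite invrK [_ *: 1]mulr1.
Qed.
End partial_derivative.

(** Jensen's inequality by a supporting line: [f ^+ 2 = exp (2 ln |f|)] lies above the tangent to
    the exponential at [2 l], and the tangent has expectation [exp (2 l)]. *)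
Lemma expR_integral_ln_le d (T : measurableType d) (R : realType) (P : probability T R)
    (f : T -> R) :
  measurable_fun setT f -> {ae P, forall w, f w != 0} ->
  P.-integrable setT (fun w => (ln `|f w|)%:E) ->
  (\int[P]_w (f w ^+ 2)%:E < +oo)%E ->
  ((expR (2 * fine (\int[P]_w (ln `|f w|)%:E)))%:E <= \int[P]_w (f w ^+ 2)%:E)%E.
Proof.
move=> mf f0 il foo; have Il := integrable_fin_num measurableT il.
set l := fine _; pose e := expR (2 * l).
have i2 : P.-integrable setT (fun w => (f w ^+ 2)%:E).
  apply/integrableP; split; first exact/measurable_EFinP/measurable_funX.
  by under eq_integral do rewrite gee0_abs ?lee_fin ?sqr_ge0//.
have i1 c : P.-integrable setT (fun=> c%:E) by exact: finite_measure_integrable_cst.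
have ig := integrableD measurableT (i1 (e * (1 - 2 * l))) (integrableZl measurableT (e * 2) il).
(* The integrand is the tangent [e + e * (2 ln |f| - 2 l)], expanded; its linear part averages to 0
   by the choice of [l]. *)
have -> : ((expR (2 * l))%:E = \int[P]_w ((e * (1 - 2 * l))%:E + (e * 2)%:E * (ln `|f w|)%:E))%E.
  rewrite integralD//=; last exact: integrableZl.
  rewrite integralZl//.
  have -> : (\int[P]_w (e * (1 - 2 * l))%:E = (e * (1 - 2 * l))%:E)%E.
    exact: (etrans (integral_cst P measurableT (_%:E : \bar R))
      (etrans (congr1 _ (probability_setT P)) (mule1 _))).
  rewrite -[X in (_ + _ * X)%E](fineK Il) -/l -EFinM -EFinD -/e; congr (_%:E).
  ring.
apply: ae_le_integral => //; apply: filterS f0 => w fw.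
have lw : 0 < `|f w| by rewrite normr_gt0.
rewrite -EFinM -EFinD lee_fin.
(* e^x >= 1 + x at x = 2 ln |f w| - 2 l *)
have -> : f w ^+ 2 = e * expR (2 * ln `|f w| - 2 * l).
  rewrite -expRD addrC subrK mulr2n mulrDl !mul1r expRD lnK ?posrE//.
  by rewrite -expr2 real_normK// num_real.
have /(ler_wpM2l (expR_ge0 (2 * l))) := @expR_ge1Dx R (2 * ln `|f w| - 2 * l).
rewrite -/e; apply: le_trans.
by rewrite le_eqVlt; apply/orP; left; apply/eqP; ring.
Qed.

(** * Assembly of the two bounds on the sensitivity index *)

Theorem mainTheorem2 (R : realType)
  (disp : measure_display) (T : measurableType disp) (P : probability T R)
  (d : nat) (X : {RV P >-> d.-tuple (measurableTypeR R)})
  (fX : d.-tuple (measurableTypeR R) -> R)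
  (g : 'rV[R]_d -> R) (i : 'I_d)
  (* densities of X_i, of X_{~i}, of Y and of (Y, X_{~i}) *)
  (fXi : measurableTypeR R -> R)
  (fXni : d.-1.-tuple (measurableTypeR R) -> R)
  (fY : measurableTypeR R -> R)
  (fYXni : measurableTypeR R * d.-1.-tuple (measurableTypeR R) -> R) :
  let Xi : T -> measurableTypeR R := fun w => tnth (X w) i in
  let Xni : T -> d.-1.-tuple (measurableTypeR R) :=
    fun w => drop_coord i (X w) in
  let Y : T -> measurableTypeR R := fun w => g (row_of_tuple (X w)) in
  let dg (j : 'I_d) : T -> R := fun w => partial g j (row_of_tuple (X w)) in
  let l := (\int[P]_w lne `|dg i w|%:E)%E in
  let nu (j : 'I_d) := 'E_P[(fun w => dg j w ^+ 2)%R]%E in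
  has_pdf (lebesgue_tuple d) P X fX ->
  has_pdf lebesgue_measure P Xi fXi ->
  has_pdf (lebesgue_tuple d.-1) P Xni fXni ->
  has_pdf lebesgue_measure P Y fY ->
  has_pdf (@lebesgue_measure R \x lebesgue_tuple d.-1)%E P (fun w => (Y w, Xni w)) fYXni ->
  finite_entropy (lebesgue_tuple d) fX ->
  finite_entropy lebesgue_measure fXi ->
  finite_entropy (lebesgue_tuple d.-1) fXni ->
  finite_entropy lebesgue_measure fY ->
  finite_entropy (@lebesgue_measure R \x lebesgue_tuple d.-1)%E fYXni ->
  (forall x, differentiable g x) ->
  (forall j, (nu j < +oo)%E) ->
  P.-integrable setT (fun w => lne `|dg i w|%:E) ->
  let HT := cond_entropy P Xni fYXni fXni in
  let HY := diff_entropy lebesgue_measure fY in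
  let HXi := diff_entropy lebesgue_measure fXi in
  let kappa := expR HT / expR HY in
  [/\ kappa <= expR HXi / expR HY * expR (fine l),
      kappa ^+ 2 = expR (2 * HT) / expR (2 * HY) &
      kappa ^+ 2 <= expR (2 * HXi) / expR (2 * HY) * fine (nu i)].
Proof.
(* For [d = 0] there is no index [i]. *)
case: d X fX g i fXni fYXni => [|n] X fX g i fXni fYXni; first by case: i.
move=> Xi Xni Y dg l nu hX hXi hXni hY hYX eX eXi eXni eY eYX Dg nuoo il HT HY HXi kappa.
have mX : measurable_fun setT X by exact: measurable_funP.
have mXi : measurable_fun setT Xi by exact: (measurableT_comp (measurable_tnth i) mX).
have mXni : measurable_fun setT Xni.
  exact: (measurableT_comp (measurable_drop_coord i) mX).
have mV : measurable_fun setT (fun w => (Xi w, Xni w)) by exact/measurable_fun_pair.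
pose gam := along i g.
pose gam' (u : measurableTypeR R * n.-tuple (measurableTypeR R)) : measurableTypeR R :=
  partial g i (row_of_tuple (insert_coord i u)).
have mgam : measurable_fun setT gam by exact: measurable_along.
have mgam' : measurable_fun setT gam' by exact: measurable_partial.
have YE : Y = fun w => gam (Xi w, Xni w).
  by apply/funext => w; rewrite /gam /along insert_coordK.
have dgE : dg i = fun w => gam' (Xi w, Xni w).
  by apply/funext => w; rewrite /gam' insert_coordK.
have mY : measurable_fun setT Y by rewrite YE; exact: measurableT_comp mV.
have mdg : measurable_fun setT (dg i) by rewrite dgE; exact: measurableT_comp mV.
(* [lne] is minus infinity at 0, while an integrable function is finite almost everywhere. This also
   lets the real [ln], with its default value at 0, replace [lne]. *)
have dg0 : {ae P, forall w, dg i w != 0}.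
  apply: filterS (integrable_ae measurableT il) => w /(_ I).
  by apply: contraTneq => ->; rewrite normr0 le0_lneNy.
have aeln : ae_eq P setT (fun w => lne `|dg i w|%:E) (fun w => (ln `|dg i w|)%:E).
  by apply: filterS dg0 => w dgw _; rewrite lne_EFin ?normr_gt0.
have mln : measurable_fun setT (fun w => (ln `|dg i w|)%:E).
  by apply/measurable_EFinP; apply: measurableT_comp => //; exact: measurableT_comp.
have iln := ae_eq_integrable mln il aeln.
have lE : l = (\int[P]_w (ln `|dg i w|)%:E)%E.
  by apply: ae_eq_integral => //; exact: measurable_int il.
have HTE : HT = diff_entropy (@lebesgue_measure R \x lebesgue_tuple n)%E fYXni -
    diff_entropy (lebesgue_tuple n) fXni.
  exact: (cond_entropyE mY mXni hYX hXni eYX eXni).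
have HTle : HT <= HXi + fine l.
  have hp := has_pdf_split i hX.
  have dgam x z : is_derive (x : R) (1 : R) (fun t : R => gam (t, z) : R) (gam' (x, z)).
    exact: is_derive_along.
  have hq := hYX; rewrite YE in hq.
  have := total_entropy_le mXi mXni mgam mgam' dgam hp hq hXi hXni eYX eXi eXni.
  have lE' := lE; rewrite dgE in dg0 iln lE'.
  move=> /(_ dg0 iln); rewrite -HTE -lE'.
  have /fineK <- : l \is a fin_num by rewrite lE'; exact: integrable_fin_num iln.
  by rewrite -EFinD lee_fin.
have nuE : (expR (2 * fine l) <= fine (nu i)).
  have nui : nu i = (\int[P]_w (dg i w ^+ 2)%:E)%E by rewrite /nu unlock.
  have := expR_integral_ln_le mdg dg0 iln; rewrite -nui -lE => /(_ (nuoo i)).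
  have /fineK <- : nu i \is a fin_num.
    by rewrite ge0_fin_numE// nui integral_ge0// => w _; rewrite lee_fin sqr_ge0.
  by rewrite lee_fin.
have kE : kappa ^+ 2 = expR (2 * HT) / expR (2 * HY).
  by rewrite /kappa expr_div_n !mulr2n !mulrDl !mul1r !expRD -!expr2.
split => //.
- rewrite /kappa -mulrAC ler_pM2r ?invr_gt0 ?expR_gt0//.
  by rewrite -expRD ler_expR.
- rewrite kE -mulrAC ler_pM2r ?invr_gt0 ?expR_gt0//.
  (* The doubled entropy bound comes first, then [e^{2l} <= nu_i]. *)
  apply: (@le_trans _ _ (expR (2 * HXi) * expR (2 * fine l))).
    by rewrite -expRD ler_expR -mulrDr ler_pM2l.
  by rewrite ler_pM2l ?expR_gt0.
Qed.
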